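(* Let $F=\{\mathbf{p}_0,\ldots,\mathbf{p}_n\}\subset\mathbb{R}^d$ be not contained in any $(d-1)$-dimensional affine subspace and let $k\ge1$. There exists a set $\mathcal{O}\subseteq\mathcal{P}_k$ which is open and dense in $\mathcal{P}_k$ such that for every $(\lambda_0,\ldots,\lambda_n)\in\mathcal{O}$, for the IFS $S_i(\mathbf{x})=\lambda_i\mathbf{x}+(1-\lambda_i)\mathbf{p}_i$ ($i=0,\ldots,n$), the set $X_k$ contains an open dense subset of $X$ and Lebesgue almost every $\mathbf{x}\in X$ belongs to $X_k$.
   Context: Write $\mathcal{D}=\{0,\ldots,n\}$ and $\mathcal{P}_k=\{(\lambda_i)_{i\in\mathcal{D}}:\lambda_i\in(0,1),\ \prod_{i\in\mathcal{D}}\lambda_i^{k(n+1)^{k-1}}\ge\frac{d}{d+1}\}$, with the topology inherited from $\mathbb{R}^{n+1}$. $X$ is the unique non-empty compact set with $X=\bigcup_{i\in\mathcal{D}}S_i(X)$; ''open dense subset of $X$'' refers to the relative topology of $X$. The coding map is $\pi(\mathbf{a})=\lim_{j\to\infty}(S_{a_1}\circ\cdots\circ S_{a_j})(\mathbf{0})$. For $\mathbf{b}\in\mathcal{D}^k$, $\mathrm{freq}_{\mathbf{b}}(\mathbf{a})=\lim_{m\to\infty}\frac1m\#\{1\le j\le m:a_j\cdots a_{j+k-1}=\mathbf{b}\}$; $\mathbf{a}$ is $k$-simply normal if this equals $(n+1)^{-k}$ for all $\mathbf{b}\in\mathcal{D}^k$. $X_k$ is the set of $\mathbf{x}\in X$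 having a $k$-simply normal $\mathbf{a}$ with $\pi(\mathbf{a})=\mathbf{x}$. *)

(* Defs.v *)
From HB Require Import structures.
From mathcomp Require Import all_boot all_order all_algebra.
From mathcomp Require Import all_classical all_reals all_analysis.
Set Implicit Arguments. Unset Strict Implicit. Unset Printing Implicit Defensive.
Import Order.TTheory GRing.Theory Num.Theory.
Import numFieldNormedType.Exports.
Local Open Scope classical_set_scope.
Local Open Scope ring_scope.

Section IFS.
Variable R : realType.

Definition not_in_hyperplane (d n : nat) (p : 'I_n.+1 -> 'rV[R]_d) : Prop :=
  ~ (exists (a : 'rV[R]_d) (c : R), a != 0 /\
       forall i : 'I_n.+1, (p i *m a^T) 0 0 = c).

Definition Pk (d n k : nat) : set 'rV[R]_n.+1 :=
  [set lam | (forall i : 'I_n.+1, 0 < lam 0 i < 1) /\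
     (d%:R / d.+1%:R <= \prod_(i < n.+1) (lam 0 i) ^+ (k * n.+1 ^ k.-1)%N)].

Definition Smap (d n : nat) (lam : 'rV[R]_n.+1) (p : 'I_n.+1 -> 'rV[R]_d)
  (i : 'I_n.+1) (x : 'rV[R]_d) : 'rV[R]_d :=
  lam 0 i *: x + (1 - lam 0 i) *: p i.

(* compS a j x = S_{a 0} o S_{a 1} o ... o S_{a (j-1)} (x).
   A coding sequence (a_1, a_2, ...) is represented as a : nat -> 'I_n.+1
   with a j standing for a_{j+1}. *)
Fixpoint compS (d n : nat) (lam : 'rV[R]_n.+1) (p : 'I_n.+1 -> 'rV[R]_d)
  (a : nat -> 'I_n.+1) (j : nat) (x : 'rV[R]_d) : 'rV[R]_d :=
  match j with
  | 0 => x
  | j'.+1 => compS lam p a j' (Smap lam p (a j') x)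
  end.

Definition coding (d n : nat) (lam : 'rV[R]_n.+1) (p : 'I_n.+1 -> 'rV[R]_d)
  (a : nat -> 'I_n.+1) (x : 'rV[R]_d) : Prop :=
  (fun j => compS lam p a j 0) @ \oo --> x.

Definition is_attractor (d n : nat) (lam : 'rV[R]_n.+1) (p : 'I_n.+1 -> 'rV[R]_d)
  (X : set 'rV[R]_d) : Prop :=
  compact X /\ X !=set0 /\ X = \bigcup_(i in [set: 'I_n.+1]) (Smap lam p i @` X).

Definition block_count (n k : nat) (a : nat -> 'I_n.+1) (b : 'I_k -> 'I_n.+1)
  (m : nat) : nat :=
  #|[set j : 'I_m | [forall i : 'I_k, a (j + i)%N == b i]]|.

Definition simply_normal (n k : nat) (a : nat -> 'I_n.+1) : Prop :=
  forall b : 'I_k -> 'I_n.+1,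
    (fun m : nat => (block_count a b m)%:R / m%:R : R) @ \oo -->
      ((n.+1%:R) ^- k : R).

Definition Xk (d n k : nat) (lam : 'rV[R]_n.+1) (p : 'I_n.+1 -> 'rV[R]_d)
  (X : set 'rV[R]_d) : set 'rV[R]_d :=
  [set x | X x /\ exists a, simply_normal k a /\ coding lam p a x].

Definition rel_open {T : topologicalType} (A S : set T) : Prop :=
  A `<=` S /\ exists U, open U /\ A = U `&` S.
Definition rel_dense {T : topologicalType} (A S : set T) : Prop :=
  S `<=` closure A.

Definition box (d : nat) (lo hi : 'rV[R]_d) : set 'rV[R]_d :=
  [set x | forall i, lo 0 i <= x 0 i <= hi 0 i].
Definition lebesgue_null (d : nat) (N : set 'rV[R]_d) : Prop :=
  forall e : R, 0 < e -> exists lo hi : nat -> 'rV[R]_d,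
    (forall m i, lo m 0 i <= hi m 0 i) /\
    N `<=` \bigcup_m box (lo m) (hi m) /\
    (forall M, \sum_(m < M) \prod_(i < d) (hi m 0 i - lo m 0 i) <= e).

End IFS.

Arguments Pk {R} d n k _.
Arguments simply_normal {R} {n} k a.
Arguments Xk {R} {d n} k lam p X _.

(* Main.v *)
Require Import Defs.
From HB Require Import structures.
From mathcomp Require Import all_boot all_order all_algebra.
From mathcomp Require Import all_classical all_reals all_analysis.
From mathcomp Require Import zify ring lra.
Set Implicit Arguments. Unset Strict Implicit. Unset Printing Implicit Defensive.
Import Order.TTheory GRing.Theory Num.Theory.
Import numFieldNormedType.Exports.

(** Let N = n + 1 and let w be the periodic word that lists the k-digit base-N expansions of
    0, ..., N^k - 1.  Each word of length k occurs exactly k times in a period of w, and the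
    N rotations of w starting at the multiples k * c, c <= n, all begin with 0^(k-1).  Hence
    every concatenation of these rotations is k-simply normal.  The rotations act on R^d as
    homotheties of the same ratio rho >= d / (d + 1).  Their centres are not contained in a
    hyperplane: consecutive centres are mapped to one another by the maps of the words
    0^(k-1) c, so that a hyperplane containing all of them would contain all the p_i.  So
    d + 1 of the centres span a simplex, each point of which has a coding by a concatenation
    of rotations.  This works for every point of P_k, so that O = P_k will do.

    Copies of this simplex occur at every place and every scale of X, which gives density;
    the points of X without such a coding form a porous set, which is a null set. *)

(** * The word listing all k-digit expansions *)

Lemma eq_digits_mod (N m x y : nat) :
  (forall e, e < m -> x %/ N ^ e = y %/ N ^ e %[mod N]) -> x = y %[mod N ^ m].
Proof.
elim: m => [|m IHm] eq_xy; first by rewrite expn0 !modn1.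
have eq_m : x %% N ^ m.+1 %% N ^ m = y %% N ^ m.+1 %% N ^ m.
  by rewrite !modn_dvdm ?dvdn_exp2l //; apply: IHm => e em; apply/eq_xy/ltnW.
have := eq_xy m (ltnSn m); rewrite !modn_divl -expnS => eq_d.
by rewrite (divn_eq (x %% _) (N ^ m)) (divn_eq (y %% _) (N ^ m)) eq_d eq_m.
Qed.

Lemma eq_mod_digits (N m x y e : nat) : x = y %[mod N ^ m] -> e < m ->
  x %/ N ^ e = y %/ N ^ e %[mod N].
Proof.
move=> eq_xy em; rewrite !modn_divl -expnS.
by rewrite -(modn_dvdm x (dvdn_exp2l N em)) eq_xy modn_dvdm ?dvdn_exp2l.
Qed.

(** Position [j] carries digit [j %% k] of [j %/ k], most significant first. Only the low [k] digits
    are read, so the numbers wrap around at [n.+1 ^ k] and the word is periodic. *)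
Definition digit_word (n k j : nat) : 'I_n.+1 :=
  inord (((j %/ k) %/ n.+1 ^ (k.-1 - j %% k)) %% n.+1).

Section DigitWord.
Variables (n k : nat).
Hypothesis k_gt0 : 0 < k.

Let w := digit_word n k.
Let N := n.+1.
Let L := k * N ^ k.

Lemma val_digit_word (x r : nat) : r < k ->
  w (r + k * x) = x %/ N ^ (k.-1 - r) %% N :> nat.
Proof.
move=> rk; rewrite inordK ?ltn_mod //.
have -> : (r + k * x) %/ k = x by rewrite addnC mulnC divnMDl // divn_small // addn0.
by have -> : (r + k * x) %% k = r by rewrite addnC mulnC modnMDl modn_small.
Qed.

Lemma digit_word_period (j : nat) : w (j + L) = w j.
Proof.
apply: val_inj; rewrite (divn_eq j k) [_ %/ k * k + _]addnC [_ %/ k * k]mulnC.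
rewrite -addnA -mulnDr /= !val_digit_word ?ltn_mod //.
by apply: (@eq_mod_digits N k); rewrite ?modnDr // -subSn ?leq_subr //; lia.
Qed.

Lemma digit_word_prefix (s c : nat) : s < k.-1 -> c <= n -> w (s + k * c) = ord0.
Proof.
move=> sk cn; apply: val_inj; rewrite /= val_digit_word; last by lia.
have e_gt0 : 0 < k.-1 - s by rewrite subn_gt0.
rewrite divn_small ?mod0n //; apply: leq_ltn_trans cn _.
by rewrite -[X in X <= _]expn1; apply: leq_pexp2l.
Qed.

Lemma digit_word_last (c : nat) : c <= n -> w (k.-1 + k * c) = c :> nat.
Proof.
by move=> cn; rewrite val_digit_word ?prednK // subnn expn0 divn1 modn_small.
Qed.

(** A window at offset [r] reads the low [k - r] digits of [x], then the top [r] digits of [x.+1].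
    The former determine [x.+1] modulo [N ^ (k - r)]; the latter complete it modulo [N ^ k]. *)
Lemma digit_window_inj (r x y : nat) : r < k -> x < N ^ k -> y < N ^ k ->
  (forall i, i < k -> w (r + k * x + i) = w (r + k * y + i)) -> x = y.
Proof.
move=> rk xk yk eq_w.
have low e : e < k - r -> x %/ N ^ e = y %/ N ^ e %[mod N].
  move=> ekr; have ik : k.-1 - e - r < k by lia.
  have rk' : k.-1 - e < k by lia.
  have sh z : r + k * z + (k.-1 - e - r) = k.-1 - e + k * z by lia.
  have e_inv : k.-1 - (k.-1 - e) = e by lia.
  have /(congr1 val) := eq_w _ ik; rewrite /= (sh x) (sh y).
  by rewrite (val_digit_word x rk') (val_digit_word y rk') e_inv.
have high e : k - r <= e < k -> x.+1 %/ N ^ e = y.+1 %/ N ^ e %[mod N].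
  move=> ekr; have ik : k.-1 - e + (k - r) < k by lia.
  have rk' : k.-1 - e < k by lia.
  have sh z : r + k * z + (k.-1 - e + (k - r)) = k.-1 - e + k * z.+1 by rewrite mulnS; lia.
  have e_inv : k.-1 - (k.-1 - e) = e by lia.
  have /(congr1 val) := eq_w _ ik; rewrite /= (sh x) (sh y).
  by rewrite (val_digit_word x.+1 rk') (val_digit_word y.+1 rk') e_inv.
have /eqP eqS : x.+1 = y.+1 %[mod N ^ k].
  apply: eq_digits_mod => e ek; case: (ltnP e (k - r)) => ekr; last by apply: high; rewrite ekr.
  apply: (@eq_mod_digits N (k - r)) => //.
  by apply/eqP; rewrite -addn1 -[y.+1]addn1 eqn_modDr; apply/eqP/eq_digits_mod.
by move: eqS; rewrite -addn1 -[y.+1]addn1 eqn_modDr !modn_small // => /eqP.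
Qed.

Definition window (a : nat -> 'I_n.+1) (b : 'I_k -> 'I_n.+1) (j : nat) : bool :=
  [forall i : 'I_k, a (j + i) == b i].

(** At each of the [k] offsets, [digit_window_inj] and equal cardinalities make [x] correspond
    bijectively to its window, so [b] occurs once per offset. *)
Lemma window_digit_word_count (b : 'I_k -> 'I_n.+1) : \sum_(j < L) window w b j = k.
Proof.
rewrite -(big_mkord xpredT (fun j => window w b j : nat)) /L mulnC big_nat_mul big_mkord.
have -> : \sum_(i < N ^ k) \sum_(i * k <= j < i.+1 * k) window w b j
  = \sum_(i < N ^ k) \sum_(r < k) window w b (r + k * i).
  apply: eq_bigr => i _; rewrite -{1}[i * k]add0n big_addn mulSn addnK big_mkord.
  by apply: eq_bigr => r _; rewrite mulnC.
rewrite exchange_big /= -[RHS]mul1n -[in RHS](card_ord k) mulnC -sum_nat_const.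
apply: eq_bigr => r _.
pose f (x : 'I_(N ^ k)) := [ffun i : 'I_k => w (r + k * x + i)].
have f_inj : injective f.
  move=> x y /ffunP eq_f; apply: val_inj.
  apply: (digit_window_inj (ltn_ord r) (ltn_ord x) (ltn_ord y)) => i ik.
  by have := eq_f (Ordinal ik); rewrite !ffunE.
have [g fK gK] : bijective f.
  by apply: inj_card_bij => //; rewrite card_ffun !card_ord.
rewrite (bigD1 (g [ffun i => b i])) //= big1 ?addn0; last first.
  move=> x xg; apply/eqP; rewrite eqb0; apply: contra xg => /forallP bx.
  rewrite -[x]fK; apply/eqP; congr g; apply/ffunP => i; rewrite !ffunE; exact/eqP.
suff -> : window w b (r + k * g [ffun i => b i]) by [].
apply/forallP => i; have /ffunP/(_ i) := gK [ffun i => b i].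
by rewrite !ffunE => ->.
Qed.

(** Windows are counted by first letter: [i] starts [N ^ k.-1] words, each occurring [k] times in a
    period. *)
Lemma digit_word_count (i : 'I_n.+1) : \sum_(j < L) (w j == i) = k * N ^ k.-1.
Proof.
pose z := Ordinal k_gt0.
transitivity (\sum_(j < L) \sum_(b : {ffun 'I_k -> 'I_n.+1}) (b z == i) * window w b j).
  apply: eq_bigr => j _; rewrite (bigD1 [ffun s : 'I_k => w (j + s)]) //= big1.
    rewrite ffunE !addn0; case: (w j == i) => //.
    by rewrite mul1n; congr nat_of_bool; apply/esym/forallP => s; rewrite ffunE.
  move=> b /eqP b_neq; apply/eqP; rewrite muln_eq0 !eqb0 orbC; apply/orP; left.
  by apply/negP => /forallP bw; apply: b_neq; apply/ffunP => s; rewrite ffunE (eqP (bw s)).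
rewrite exchange_big /=.
under eq_bigr => b _ do rewrite -big_distrr /= window_digit_word_count.
rewrite -big_distrl mulnC /=; congr muln.
pose G (s : 'I_k) (c : 'I_n.+1) : nat := if s == z then (c == i : nat) else 1.
transitivity (\sum_(b : {ffun 'I_k -> 'I_n.+1}) \prod_(s < k) G s (b s)).
  apply: eq_bigr => b _; rewrite (bigD1 z) //= big1 /G ?eqxx ?muln1 // => s /negPf -> //.
rewrite -bigA_distr_bigA (bigD1 z) //= {1}/G eqxx (bigD1 i) //= eqxx big1.
  rewrite mul1n (eq_bigr (fun=> N)) => [|s /negPf zs].
    by rewrite prod_nat_const cardC1 card_ord.
  by rewrite /G zs sum_nat_const card_ord muln1.
by move=> c /negPf ->.
Qed.

End DigitWord.

Lemma big_shift_period (T : Type) (idx : T) (op : Monoid.com_law idx) (L s : nat)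
    (f : nat -> T) : (forall j, f (j + L) = f j) ->
  \big[op/idx]_(j < L) f (j + s) = \big[op/idx]_(j < L) f j.
Proof.
move=> fL; elim: s => [|s <-]; first by apply: eq_bigr => j _; rewrite addn0.
case: L fL => [|L] fL; first by rewrite !big_ord0.
rewrite big_ord_recr big_ord_recl /= Monoid.mulmC; congr (op _ _).
  by rewrite -[RHS]fL; congr f; lia.
by apply: eq_bigr => j _; rewrite /bump /= add1n addSnnS.
Qed.

(** * Bounded discrepancy *)

Lemma block_countE (n k : nat) (a : nat -> 'I_n.+1) (b : 'I_k -> 'I_n.+1) (m : nat) :
  block_count a b m = \sum_(j < m) window a b j.
Proof.
rewrite /block_count -sum1_card big_mkcond /=; apply: eq_bigr => j _.
have -> : (j \in [set i : 'I_m | window a b i]%classic) = window a b j.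
  by apply/idP/idP; rewrite inE.
by case: (window _ _ _).
Qed.

(** A quantitative form of simple normality with denominators cleared; prepending a letter only
    changes [C]. *)
Definition bounded_discrepancy (n k : nat) (a : nat -> 'I_n.+1) : Prop :=
  exists C : nat, forall (b : 'I_k -> 'I_n.+1) (m : nat),
    n.+1 ^ k * block_count a b m <= m + C /\ m <= n.+1 ^ k * block_count a b m + C.

Definition cons_seq (n : nat) (i : 'I_n.+1) (a : nat -> 'I_n.+1) (j : nat) : 'I_n.+1 :=
  if j is j'.+1 then a j' else i.

Lemma bounded_discrepancy_cons (n k : nat) (i : 'I_n.+1) (a : nat -> 'I_n.+1) :
  bounded_discrepancy k a -> bounded_discrepancy k (cons_seq i a).
Proof.
move=> [C dC]; exists (C + n.+1 ^ k + 1) => b [|m].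
  by rewrite block_countE big_ord0; lia.
have -> : block_count (cons_seq i a) b m.+1 = window (cons_seq i a) b 0 + block_count a b m.
  by rewrite !block_countE big_ord_recl.
have [] := dC b m; have : window (cons_seq i a) b 0 <= 1 by case: (window _ _ _).
set u := nat_of_bool _; set c := block_count _ _ _; set M := n.+1 ^ k => *.
by rewrite mulnDr; nia.
Qed.

(** * Concatenations of rotations of the periodic word *)

Section Splice.
Variables (n k : nat) (c : nat -> 'I_n.+1).
Hypothesis k_gt0 : 0 < k.

Let w := digit_word n k.
Let L := k * n.+1 ^ k.

Let wL (j : nat) : w (j + L) = w j. Proof. exact: digit_word_period. Qed.

(** Block [m] is one period of the digit word, read from position [k * c m]. *)
Definition splice (j : nat) : 'I_n.+1 :=
  digit_word n k (j %% (k * n.+1 ^ k) + k * c (j %/ (k * n.+1 ^ k))).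

Lemma period_gt0 : 0 < L. Proof. by rewrite muln_gt0 k_gt0 expn_gt0. Qed.

Lemma leq_k_period : k <= L. Proof. by rewrite leq_pmulr // expn_gt0. Qed.

Lemma splice_block (r m : nat) : r < L -> splice (r + L * m) = w (r + k * c m).
Proof.
move=> rL; rewrite /splice -/L; have L_gt0 := period_gt0.
have -> : (r + L * m) %/ L = m by rewrite addnC mulnC divnMDl // divn_small // addn0.
by have -> : (r + L * m) %% L = r by rewrite addnC mulnC modnMDl modn_small.
Qed.

(* Every block starts with the same k.-1 letters, so a window straddling two blocks reads as in
   the periodic word. *)
Lemma splice_window (r m i : nat) : r < L -> i < k ->
  splice (r + L * m + i) = w (r + k * c m + i).
Proof.
move=> rL ik; have kL := leq_k_period.
case: (ltnP (r + i) L) => riL; first by rewrite addnAC splice_block // addnAC.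
have -> : r + L * m + i = (r + i - L) + L * m.+1 by rewrite mulnS; lia.
have -> : r + k * c m + i = (r + i - L + k * c m) + L by lia.
have sk : r + i - L < k.-1 by lia.
have cn q : c q <= n by rewrite -ltnS.
have sL : r + i - L < L by lia.
by rewrite splice_block // wL /w !digit_word_prefix.
Qed.

Lemma splice_block_count (b : 'I_k -> 'I_n.+1) (m : nat) :
  block_count splice b (L * m) = k * m.
Proof.
rewrite block_countE -(big_mkord xpredT (fun j => window splice b j : nat)) [L * m]mulnC.
rewrite big_nat_mul big_mkord.
have -> : k * m = \sum_(i < m) k by rewrite sum_nat_const card_ord mulnC.
apply: eq_bigr => i _; rewrite -{1}[i * L]add0n big_addn mulSn addnK big_mkord.
rewrite -[RHS](window_digit_word_count k_gt0 b).
rewrite -(@big_shift_period _ _ _ L (k * c i) (fun j => window w b j : nat)); last first.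
  by move=> j; congr nat_of_bool; apply: eq_forallb => s; rewrite addnAC wL.
apply: eq_bigr => r _; congr nat_of_bool; apply: eq_forallb => s.
by rewrite mulnC splice_window // ltn_ord.
Qed.

Lemma splice_bounded_discrepancy : bounded_discrepancy k splice.
Proof.
(* Complete blocks have the exact frequency; the last [r < L] positions cost at most [n.+1 ^ k * L]
   upwards and [L] downwards. *)
exists (n.+1 ^ k * L + L) => b m; have L_gt0 := period_gt0.
have Lq q : n.+1 ^ k * (k * q) = L * q by rewrite /L mulnA [_ * k]mulnC.
have [q [r [rL ->]]] : exists q r, r < L /\ m = L * q + r.
  by exists (m %/ L), (m %% L); rewrite ltn_mod mulnC -divn_eq.
have /andP[lo hi] : k * q <= block_count splice b (L * q + r) <= k * q + r.
  rewrite -(splice_block_count b) !block_countE big_split_ord /= leq_addr leq_add2l.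
  apply: (@leq_trans (\sum_(i < r) 1)); last by rewrite sum_nat_const card_ord muln1.
  by apply: leq_sum => j _; case: (window _ _ _).
set B := block_count _ _ _ in lo hi *.
have := leq_mul (leqnn (n.+1 ^ k)) lo; have := leq_mul (leqnn (n.+1 ^ k)) hi.
have := leq_mul (leqnn (n.+1 ^ k)) (ltnW rL).
by rewrite mulnDr Lq => *; split; lia.
Qed.

End Splice.

Local Open Scope classical_set_scope.
Local Open Scope ring_scope.

Lemma bounded_discrepancy_normal (R : realType) (n k : nat) (a : nat -> 'I_n.+1) :
  bounded_discrepancy k a -> @simply_normal R n k a.
Proof.
move=> [C dC] b; apply/cvgrPdist_le => /= e e0.
near=> m.
have m_gt0 : 0 < m%:R :> R by rewrite ltr0n; near: m; exact: nbhs_infty_gt.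
have Cm : C%:R / e <= m%:R by near: m; exact: nbhs_infty_ger.
have M_ge1 : 1 <= n.+1%:R ^+ k :> R by rewrite -natrX ler1n expn_gt0.
have M_gt0 := lt_le_trans ltr01 M_ge1.
have [] := dC b m; rewrite -!(ler_nat R) !natrD natrM natrX.
set M := _ ^+ k in M_ge1 M_gt0 *; set B := (block_count _ _ _)%:R => h1 h2.
have -> : M^-1 - B / m%:R = (m%:R - M * B) / (M * m%:R) by field; rewrite !gt_eqF.
rewrite normrM normfV (gtr0_norm (mulr_gt0 M_gt0 m_gt0)) ler_pdivrMr ?mulr_gt0 //.
have : C%:R <= e * m%:R by rewrite mulrC -ler_pdivrMr.
have : e * m%:R * 1 <= e * m%:R * M by rewrite ler_pM2l // mulr_gt0.
rewrite mulr1 mulrA [e * M]mulrC -mulrA [M * _]mulrC ler_norml => *; apply/andP; split; lra.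
Unshelve. all: by end_near.
Qed.

(** * Compositions of contractions and the attractor *)

Section Contractions.
Variables (R : realType) (d n : nat) (lam : 'rV[R]_n.+1) (p : 'I_n.+1 -> 'rV[R]_d).
Hypothesis lam01 : forall i, 0 < lam 0 i < 1.

Let lam_gt0 i : 0 < lam 0 i. Proof. by case/andP: (lam01 i). Qed.
Let lam_lt1 i : lam 0 i < 1. Proof. by case/andP: (lam01 i). Qed.

Definition wprod (a : nat -> 'I_n.+1) (j : nat) : R := \prod_(i < j) lam 0 (a i).

Lemma wprodS (a : nat -> 'I_n.+1) (j : nat) : wprod a j.+1 = wprod a j * lam 0 (a j).
Proof. by rewrite /wprod big_ord_recr. Qed.

Lemma wprod_gt0 (a : nat -> 'I_n.+1) (j : nat) : 0 < wprod a j.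
Proof. by apply: prodr_gt0 => i _. Qed.

Lemma eq_compS (a b : nat -> 'I_n.+1) (j : nat) (x : 'rV[R]_d) :
  (forall i, (i < j)%N -> a i = b i) -> compS lam p a j x = compS lam p b j x.
Proof.
elim: j x => //= j IHj x ab; rewrite ab // IHj // => i ij.
by apply/ab/ltnW.
Qed.

Lemma compSD (a : nat -> 'I_n.+1) (i j : nat) (x : 'rV[R]_d) :
  compS lam p a (i + j) x = compS lam p a i (compS lam p (fun s => a (i + s)%N) j x).
Proof. by elim: j x => [|j IHj] x; rewrite ?addn0 // addnS /= IHj. Qed.

Lemma compS_sub (a : nat -> 'I_n.+1) (j : nat) (x y : 'rV[R]_d) :
  compS lam p a j x - compS lam p a j y = wprod a j *: (x - y).
Proof.
elim: j x y => [|j IHj] x y /=; first by rewrite /wprod big_ord0 scale1r.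
by rewrite IHj wprodS -scalerA /Smap opprD addrACA subrr addr0 -scalerBr.
Qed.

Lemma compS_norm_le (a : nat -> 'I_n.+1) (j : nat) (x : 'rV[R]_d) (r : R) :
  (forall i, `|p i| <= r) -> `|x| <= r -> `|compS lam p a j x| <= r.
Proof.
move=> pr; elim: j x => //= j IHj x xr; apply: IHj.
rewrite /Smap (le_trans (ler_normD _ _)) // !normrZ.
rewrite (gtr0_norm (lam_gt0 _)) gtr0_norm ?subr_gt0 //.
have -> : r = lam 0 (a j) * r + (1 - lam 0 (a j)) * r by ring.
by rewrite lerD // ler_pM2l // subr_gt0.
Qed.

Lemma lam_lower_bound : exists2 mu : R, 0 < mu &
  forall i, mu <= lam 0 i.
Proof.
exists (\prod_i lam 0 i); first by apply: prodr_gt0 => i _.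
move=> i; rewrite (bigD1 i) //= ger_pMr //.
by apply: prodr_ile1 => j _; rewrite !ltW.
Qed.

Lemma wprod_small (e : R) : 0 < e -> exists m : nat,
  forall (a : nat -> 'I_n.+1) (j : nat), (m <= j)%N -> wprod a j < e.
Proof.
(* [q < 1] bounds all the ratios: the product is positive and at most each of its factors. *)
move=> e0; pose q : R := 1 - \prod_i (1 - lam 0 i).
have q_prod : 0 < \prod_i (1 - lam 0 i) <= 1.
  rewrite prodr_gt0 => [|i _]; last by rewrite subr_gt0.
  by apply: prodr_ile1 => i _; rewrite subr_ge0 ltW //= gerBl ltW.
have lam_q i : lam 0 i <= q.
  suff: \prod_i (1 - lam 0 i) <= 1 - lam 0 i by rewrite /q; lra.
  rewrite (bigD1 i) //= ger_pMr ?subr_gt0 //.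
  by apply: prodr_ile1 => j _; rewrite subr_ge0 ltW //= gerBl ltW.
have q01 : `|q| < 1 by rewrite /q ger0_norm; lra.
have /cvgrPdist_lt/(_ e e0)[m _ qm] := cvg_expr q01.
exists m => a j mj; have := qm j mj; rewrite sub0r normrN => /(le_lt_trans _) -> //.
apply: le_trans (ler_norm _); rewrite /wprod.
have -> : q ^+ j = \prod_(i < j) q by rewrite prodr_const card_ord.
by apply: ler_prod => i _; rewrite ltW //= lam_q.
Qed.

(** The maps of the word [a] contract differences by [wprod], so the starting point does not affect
    the limit as long as it stays bounded; arbitrarily large [j] suffice. *)
Lemma coding_of_bounded_tails (a : nat -> 'I_n.+1) (x : 'rV[R]_d) (r : R) :
  (forall m, exists2 j, (m <= j)%N & exists2 y, `|y| <= r & x = compS lam p a j y) ->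
  coding lam p a x.
Proof.
move=> xy; apply/cvgrPdist_lt => /= e e0.
(* The ball of radius [s] contains the tails and all [p i], so every [Smap] preserves it. *)
pose s := Num.max 0 r + \sum_i `|p i|.
have ps i : `|p i| <= s.
  by rewrite /s (bigD1 i) //= addrCA lerDl addr_ge0 ?le_max ?lexx ?sumr_ge0.
have rs : r <= s by rewrite /s (@le_trans _ _ (Num.max 0 r)) ?le_max ?lexx ?orbT // lerDl sumr_ge0.
have s0 : 0 <= s by apply: le_trans (normr_ge0 _) (ps ord0).
have e's : 0 < e / (2 * s + 1) by rewrite divr_gt0 //; lra.
have [m small] := wprod_small e's; have [j mj [y yr ->]] := xy m.
exists j => // i /= ji; rewrite -(subnKC ji) compSD compS_sub normrZ.
rewrite (gtr0_norm (wprod_gt0 _ _)).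
set z := compS _ _ _ _ _; have zs : `|z| <= s by rewrite compS_norm_le // normr0.
have yz : `|y - z| <= 2 * s + 1.
  by rewrite (le_trans (ler_normB _ _)) //; lra.
rewrite (le_lt_trans (ler_wpM2l (ltW (wprod_gt0 _ _)) yz)) //.
by rewrite -ltr_pdivlMr ?small //; lra.
Qed.

Lemma coding_cons (i : 'I_n.+1) (a : nat -> 'I_n.+1) (x : 'rV[R]_d) :
  coding lam p a x -> coding lam p (cons_seq i a) (Smap lam p i x).
Proof.
move=> ax; rewrite /coding -cvg_shiftS /=.
have -> : (fun j => compS lam p (cons_seq i a) j.+1 0)
        = (fun j => Smap lam p i (compS lam p a j 0)).
  by apply/funext => j; rewrite -[j.+1]add1n compSD.
by apply: cvgD; [apply: cvgZr | apply: cvg_cst].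
Qed.

Section Attractor.
Variable X : set 'rV[R]_d.
Hypothesis attrX : is_attractor lam p X.

Lemma attractor_compS (a : nat -> 'I_n.+1) (j : nat) (x : 'rV[R]_d) :
  X x -> X (compS lam p a j x).
Proof.
have [_ [_ XE]] := attrX.
elim: j x => //= j IHj x Xx; apply: IHj; rewrite XE; exists (a j) => //; by exists x.
Qed.

Lemma attractor_bounded : exists2 r : R, 0 < r & forall x, X x -> `|x| <= r.
Proof.
have [cX _] := attrX; have [M [Mr XM]] := compact_bounded cX.
exists (Num.max M 0 + 1) => [|x Xx]; last by apply: XM => //; rewrite ltr_pwDr // le_max lexx.
by rewrite ltr_wpDl // le_max lexx orbT.
Qed.

Lemma attractor_tails (x : 'rV[R]_d) : X x ->
  exists a, forall j, exists2 y, X y & x = compS lam p a j y.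
Proof.
move=> Xx; have [_ [_ XE]] := attrX.
have pre y : exists iz : 'I_n.+1 * 'rV[R]_d, X y -> X iz.2 /\ y = Smap lam p iz.1 iz.2.
  have [Xy|nXy] := pselect (X y); last by exists (ord0, y).
  by move: (Xy); rewrite {1}XE => -[i _ [z Xz <-]]; exists (i, z).
have [f fP] := choice pre.
pose y j := iter j (fun z => (f z).2) x.
have Xy j : X (y j) by elim: j => //= j /fP [].
exists (fun j => (f (y j)).1) => j; exists (y j) => //.
by elim: j => //= j {1}->; have [_ {1}->] := fP _ (Xy j).
Qed.

(** Starting at a point of [X] instead of 0 keeps the compositions in the closed set [X] and changes
    them by a multiple of [wprod], which tends to 0. *)
Lemma coding_attractor (a : nat -> 'I_n.+1) (x : 'rV[R]_d) : coding lam p a x -> X x.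
Proof.
move=> ax; have [cX [[x0 Xx0] _]] := attrX.
have X_closed : closed X by apply: compact_closed => //; exact: norm_hausdorff.
have [r r0 Xr] := attractor_bounded.
apply: (@closed_cvg _ _ \oo _ (fun j => compS lam p a j x0) X) => //.
  by apply: nearW => j; exact: attractor_compS.
have -> : (fun j => compS lam p a j x0) = (fun j => compS lam p a j 0 + wprod a j *: x0).
  by apply/funext => j; rewrite -[x0 in RHS]subr0 -compS_sub addrC subrK.
rewrite -[x]addr0; apply: cvgD => //; apply/cvgrPdist_lt => /= e e0.
have e'0 : 0 < e / r by rewrite divr_gt0.
have [m small] := wprod_small e'0; exists m => // j /= mj.
rewrite sub0r normrN normrZ (gtr0_norm (wprod_gt0 _ _)).
rewrite (le_lt_trans (ler_wpM2l (ltW (wprod_gt0 _ _)) (Xr _ Xx0))) //.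
by rewrite -ltr_pdivlMr // small.
Qed.

End Attractor.
End Contractions.

(** * The periodic points of the rotations *)

Lemma row_norm_le (R : realType) (d : nat) (x : 'rV[R]_d) (r : R) : 0 <= r ->
  (forall i, `|x 0 i| <= r) -> `|x| <= r.
Proof.
move=> r0 xr; rewrite [`|x|]mx_normrE; apply: bigmax_le => // -[i j] _ /=.
by rewrite ord1.
Qed.

Lemma row_entry_norm_le (R : realType) (d : nat) (x : 'rV[R]_d) (i : 'I_d) :
  `|x 0 i| <= `|x|.
Proof.
rewrite [`|x|]mx_normrE.
exact: (@le_bigmax _ R _ 0 (fun ij : 'I_1 * 'I_d => `|x ij.1 ij.2|) (0, i)).
Qed.

Section PeriodPoints.
Variables (R : realType) (d n k : nat) (lam : 'rV[R]_n.+1) (p : 'I_n.+1 -> 'rV[R]_d).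
Hypotheses (lam01 : forall i, 0 < lam 0 i < 1) (k_gt0 : (0 < k)%N).

Let w := digit_word n k.
Let L := (k * n.+1 ^ k)%N.
Let lam_gt0 i : 0 < lam 0 i. Proof. by case/andP: (lam01 i). Qed.
Let lam_lt1 i : lam 0 i < 1. Proof. by case/andP: (lam01 i). Qed.
Let wL (j : nat) : w (j + L) = w j. Proof. exact: digit_word_period. Qed.

Definition period_ratio : R := \prod_(i < n.+1) lam 0 i ^+ (k * n.+1 ^ k.-1).

Lemma period_ratio_gt0 : 0 < period_ratio.
Proof. by apply: prodr_gt0 => i _; rewrite exprn_gt0. Qed.

Lemma period_ratio_lt1 : period_ratio < 1.
Proof.
have le1 (i : 'I_n.+1) : lam 0 i ^+ (k * n.+1 ^ k.-1) <= 1.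
  by rewrite exprn_ile1 // ltW.
rewrite /period_ratio (bigD1 ord0) //=.
apply: (@le_lt_trans _ _ (lam 0 ord0 ^+ (k * n.+1 ^ k.-1))).
  by rewrite ger_pMr ?exprn_gt0 // prodr_ile1 // => i _; rewrite le1 exprn_ge0 ?ltW.
by rewrite exprn_ilt1 ?ltW // -lt0n muln_gt0 k_gt0 expn_gt0.
Qed.

(** A rotation only permutes the factors, and [digit_word_count] gives the multiplicity of each
    letter. The result is the product that [Pk] bounds below. *)
Lemma wprod_period (s : nat) : wprod lam (fun j => w (s + j)%N) L = period_ratio.
Proof.
rewrite /wprod (eq_bigr (fun j : 'I_L => lam 0 (w (j + s)%N))); last first.
  by move=> j _; rewrite addnC.
rewrite (@big_shift_period _ _ _ L s (fun j => lam 0 (w j))) => [|j]; last by rewrite wL.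
rewrite (partition_big (fun j : 'I_L => w j) xpredT) //=.
apply: eq_bigr => i _; rewrite -(digit_word_count k_gt0 i).
rewrite (eq_bigr (fun=> lam 0 i)) => [|j /eqP -> //].
by rewrite prodr_const -sum1_card big_mkcond.
Qed.

Definition period_map (s : nat) : 'rV[R]_d -> 'rV[R]_d :=
  compS lam p (fun j => digit_word n k (s + j)) (k * n.+1 ^ k).

(** The fixed point of [period_map s], from solving [x = period_ratio *: x + period_map s 0]. *)
Definition period_point (s : nat) : 'rV[R]_d := (1 - period_ratio)^-1 *: period_map s 0.

Lemma period_mapE (s : nat) (x : 'rV[R]_d) :
  period_map s x = period_ratio *: x + (1 - period_ratio) *: period_point s.
Proof.
rewrite scalerA divff ?subr_eq0 ?gt_eqF ?period_ratio_lt1 // scale1r.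
by apply/eqP; rewrite -subr_eq compS_sub subr0 wprod_period.
Qed.

Lemma period_point_unique (s : nat) (x : 'rV[R]_d) : period_map s x = x -> x = period_point s.
Proof.
move=> fix_x; have : (1 - period_ratio) *: (x - period_point s) = 0.
  by rewrite scalerBr {1}scalerBl scale1r -addrA -opprD -period_mapE fix_x subrr.
move=> /eqP; rewrite scaler_eq0 subr_eq0 gt_eqF ?period_ratio_lt1 //=.
by rewrite subr_eq0 => /eqP.
Qed.

(** Since [w (s + L) = w s], the map of the letter [w s] intertwines [period_map s.+1] with
    [period_map s], so it carries one fixed point to the other. *)
Lemma period_point_step (s : nat) :
  period_point s = Smap lam p (w s) (period_point s.+1).
Proof.
apply/esym/period_point_unique.
have -> : w s = w (s + L) by rewrite wL.
transitivity (compS lam p (fun j => w (s + j)%N) (1 + L) (period_point s.+1)); first by [].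
rewrite compSD /= addn0 -/L wL; congr Smap.
transitivity (period_map s.+1 (period_point s.+1)).
  by apply: eq_compS => i _; rewrite addnA addn1.
by rewrite period_mapE -scalerDl addrC subrK scale1r.
Qed.

Lemma period_point_period (s : nat) : period_point (s + L) = period_point s.
Proof.
rewrite /period_point; congr (_ *: _); apply: eq_compS => i _.
by rewrite addnAC -[RHS]wL.
Qed.

End PeriodPoints.

(** An affine functional vanishing at the centres is followed along the periodic word, with values
    [h s] at the period points and [P i] at the [p i]. It vanishes at [p ord0], then at the letters
    below [n], then at [n]. *)
Lemma period_points_not_in_hyperplane (R : realType) (d n k : nat)
    (lam : 'rV[R]_n.+1) (p : 'I_n.+1 -> 'rV[R]_d) :
  (forall i, 0 < lam 0 i < 1) -> (0 < k)%N -> not_in_hyperplane p ->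
  not_in_hyperplane (fun c : 'I_n.+1 => period_point k lam p (k * c)).
Proof.
move=> lam01 k_gt0 np [a [c [a0 Qc]]]; apply: np; exists a, c; split => // i0.
pose w := digit_word n k.
pose h s := (period_point k lam p s *m a^T) 0 0 - c.
pose P i := (p i *m a^T) 0 0 - c.
suff P0 : forall i, P i = 0 by apply/eqP; rewrite -subr_eq0; apply/eqP/P0.
have lam_gt0 i : 0 < lam 0 i by case/andP: (lam01 i).
have lam_lt1 i : 0 < 1 - lam 0 i by rewrite subr_gt0; case/andP: (lam01 i).
have lin x y b c' : ((b *: x + c' *: y) *m a^T) 0 0
    = b * (x *m a^T) 0 0 + c' * (y *m a^T) 0 0.
  by rewrite mulmxDl -!scalemxAl mxE; congr (_ + _); rewrite mxE.
have h_step s : h s = lam 0 (w s) * h s.+1 + (1 - lam 0 (w s)) * P (w s).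
  rewrite /h period_point_step // lin /P -/w; ring.
have hk m : (m <= n)%N -> h (k * m)%N = 0.
  by move=> mn; have := Qc (Ordinal (mn : m < n.+1)%N); rewrite /h /= => ->; rewrite subrr.
have w_prefix s m : (s < k.-1)%N -> (m <= n)%N -> w (s + k * m)%N = ord0.
  exact: digit_word_prefix.
have w_last m : (m <= n)%N -> w (k.-1 + k * m)%N = inord m.
  by move=> mn; apply: val_inj; rewrite /= digit_word_last // inordK.
have h_last m : P ord0 = 0 -> (m <= n)%N -> h (k.-1 + k * m)%N = 0.
  move=> P00 mn; suff : forall s, (s <= k.-1)%N -> h (s + k * m)%N = 0 by apply.
  elim=> [|s IHs] sk; first by rewrite add0n hk.
  have := IHs (ltnW sk); rewrite h_step w_prefix // P00 mulr0 addr0 => /eqP.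
  by rewrite mulf_eq0 gt_eqF //= => /eqP.
(* The last letter [i] of its block joins a zero of [h] to the next centre, also a zero; that centre
   has index [i.+1], whence [i < n]. *)
have P_lt (i : 'I_n.+1) : (i < n)%N -> P ord0 = 0 -> P i = 0.
  move=> i_n P00; have := h_last i P00 (ltnW i_n).
  rewrite h_step (w_last _ (ltnW i_n)) inord_val.
  have -> : (k.-1 + k * i).+1 = (k * i.+1)%N by rewrite mulnS -addSn prednK.
  rewrite hk // mulr0 add0r => /eqP.
  by rewrite mulf_eq0 gt_eqF //= => /eqP.
(* The block of the number 0 is a homothety about [p ord0] of ratio below 1, sending centre 1 to
   centre 0; a functional zero at both is zero at [p ord0]. *)
have P00 : (0 < n)%N -> P ord0 = 0.
  move=> n_gt0; have h_exp s : (s <= k)%N -> - P ord0 = lam 0 ord0 ^+ s * (h s - P ord0).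
    elim: s => [|s IHs] sk; first by have := hk 0%N isT; rewrite muln0 => ->; rewrite mul1r sub0r.
    rewrite [LHS]IHs 1?ltnW // exprSr -mulrA; congr (_ * _); rewrite h_step.
    have -> : w s = ord0; last by ring.
    have [sk1|sk1] := ltnP s k.-1; first by have := w_prefix s 0%N sk1 isT; rewrite muln0 addn0.
    have -> : s = k.-1 by lia.
    by have := w_last 0%N isT; rewrite muln0 addn0 => ->; apply: val_inj; rewrite /= inordK.
  have := h_exp k (leqnn k); have := hk 1%N n_gt0; rewrite muln1 => -> /eqP.
  rewrite sub0r mulrN eqr_opp -subr_eq0 -{1}[P ord0]mul1r -mulrBl mulf_eq0.
  have lamk : lam 0 ord0 ^+ k < 1.
    by have /andP[l0 l1] := lam01 ord0; rewrite exprn_ilt1 ?(ltW l0) // -lt0n.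
  by rewrite subr_eq0 gt_eqF //= => /eqP.
have P_n (i : 'I_n.+1) : (i : nat) != n -> P i = 0.
  move=> i_n; have i_lt : (i < n)%N by rewrite ltn_neqAle i_n; exact: (ltn_ord i).
  by apply: P_lt => //; apply: P00; apply: leq_ltn_trans i_lt.
(* P vanishes at the letters other than n, so h s * P i >= 0 for all s; being 0 at s = 0, it is 0
   along the whole period, which forces P n = 0. *)
move=> i; case: (eqVneq (i : nat) n) => [i_n|]; last exact: P_n.
pose L := (k * n.+1 ^ k)%N.
have P_ge0 s : 0 <= (1 - lam 0 (w s)) * P (w s) * P i.
  rewrite -mulrA; apply: mulr_ge0; first exact: ltW.
  case: (eqVneq (w s) i) => [->|wi]; first by rewrite -expr2 sqr_ge0.
  rewrite P_n ?mul0r //; apply: contra wi => /eqP w_n.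
  by apply/eqP/val_inj; rewrite /= w_n i_n.
have h_ge0 s : (s <= L)%N -> 0 <= h (L - s)%N * P i.
  elim: s => [|s IHs] sL.
    rewrite subn0 -[L]add0n /h period_point_period // -/(h 0%N).
    by have := hk 0%N isT; rewrite muln0 => ->; rewrite mul0r.
  rewrite h_step; have -> : (L - s.+1).+1 = (L - s)%N by lia.
  rewrite mulrDl; apply: addr_ge0; last exact: P_ge0.
  by rewrite -mulrA; apply: mulr_ge0; [exact: ltW | apply: IHs; exact: ltnW].
have h_fwd s : (s <= L)%N -> h s * P i = 0.
  elim: s => [|s IHs] sL; first by have := hk 0%N isT; rewrite muln0 => ->; rewrite mul0r.
  have := IHs (ltnW sL); rewrite h_step mulrDl => /eqP; rewrite paddr_eq0 ?P_ge0 //.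
    by rewrite -mulrA mulf_eq0 gt_eqF //= => /andP[/eqP].
  rewrite -mulrA; apply: mulr_ge0; first exact: ltW.
  by rewrite -(subKn sL) h_ge0 // leq_subr.
have sL : (k.-1 + k * n < L)%N.
  apply: (@leq_trans (k * n.+1)); first by rewrite mulnS -addSn prednK.
  by rewrite leq_mul2l -{1}[n.+1]expn1 leq_pexp2l // orbT.
(* Position [k.-1 + k * n] carries the letter [n], and [h s * P i] vanishes on both sides of it, so
   the square of [P i] is zero. *)
have := h_fwd _ (ltnW sL); have := h_fwd _ sL; rewrite (h_step (k.-1 + k * n)%N) w_last //.
have -> : inord n = i by apply: val_inj; rewrite /= inordK.
move=> h1; rewrite mulrDl -mulrA h1 mulr0 add0r -mulrA => /eqP.
by rewrite mulf_eq0 gt_eqF //= mulf_eq0 orbb => /eqP.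
Qed.

(** * A simplex of normal points *)

(** Otherwise some nonzero [v] is orthogonal to every [q i - q ord0], hence normal to a hyperplane
    through all [q i]. *)
Lemma not_in_hyperplane_row_full (R : realType) (d n : nat) (q : 'I_n.+1 -> 'rV[R]_d) :
  not_in_hyperplane q -> row_full (\matrix_(i < n.+1) (q i - q ord0)).
Proof.
move=> nq; apply/negPn/negP => not_full; apply: nq.
set A := \matrix_i _ in not_full.
have : kermx A^T != 0.
  rewrite -mxrank_eq0 mxrank_ker mxrank_tr subn_eq0 -ltnNge ltn_neqAle.
  by rewrite rank_leq_col andbT.
move=> /rowV0Pn[v /sub_kermxP vA v0]; exists v, ((q ord0 *m v^T) 0 0); split => // i.
have /matrixP/(_ i 0) : A *m v^T = 0 by rewrite -[A]trmxK -trmx_mul vA trmx0.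
rewrite -[LHS]/((A *m v^T) i 0) -[A *m v^T]/(A *m v^T) [RHS]mxE => Avi.
have := congr1 (fun B : 'rV[R]_1 => B 0 0) (row_mul i A v^T); rewrite mxE Avi rowK mulmxBl !mxE.
by move=> /esym/eqP; rewrite subr_eq0 => /eqP.
Qed.

Section Simplex.
Variables (R : realType) (d n : nat) (q : 'I_n.+1 -> 'rV[R]_d) (rho : R).
Hypotheses (d_gt0 : (0 < d)%N) (nq : not_in_hyperplane q).
Hypotheses (rho_ge : d%:R / d.+1%:R <= rho) (rho_gt0 : 0 < rho).

(* A point of a simplex has a barycentric coordinate at least 1 / d.+1 >= 1 - rho, so it lies in
   the image of the simplex under the homothety of ratio rho centred at that vertex. *)
Lemma simplex_self_cover : exists D : set 'rV[R]_d,
  [/\ exists r, forall x, D x -> `|x| <= r,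
      exists x r, 0 < r /\ ball x r `<=` D
    & forall x, D x -> exists c y, D y /\ x = rho *: y + (1 - rho) *: q c].
Proof.
have full := not_in_hyperplane_row_full nq; set A := \matrix_i _ in full.
(* [V] collects [d] independent edges at [q ord0]. The entries of [t x] below are the barycentric
   coordinates at the [q (f i)]; 1 minus their sum is the one at [q ord0]. *)
pose f := fullrankfun full; pose V := rowsub f A.
have Vu : V \in unitmx by exact: fullrowsub_unit.
have rowV i : row i V = q (f i) - q ord0 by rewrite row_rowsub rowK.
pose t (x : 'rV[R]_d) := (x - q ord0) *m invmx V.
have tK x : x = q ord0 + t x *m V by rewrite /t mulmxKV // addrC subrK.
have tE u : t (q ord0 + u *m V) = u by rewrite /t addrC addKr mulmxK.
pose D := [set x | (forall i, 0 <= t x 0 i) /\ \sum_i t x 0 i <= 1].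
have d_pos : 0 < d%:R :> R by rewrite ltr0n.
exists D; split.
- exists (`|q ord0| + \sum_i `|row i V|) => x [t0 t1].
  rewrite (tK x) (le_trans (ler_normD _ _)) // lerD2l mulmx_sum_row.
  rewrite (le_trans (ler_norm_sum _ _ _)) // ler_sum // => i _.
  rewrite normrZ -[X in _ <= X]mul1r ler_wpM2r // ger0_norm //.
  by rewrite (le_trans _ t1) // (bigD1 i) //= lerDl sumr_ge0.
- pose C : R := \sum_i \sum_j `|invmx V i j|.
  have C0 : 0 <= C by apply: sumr_ge0 => i _; apply: sumr_ge0.
  (* The centre of the ball has all coordinates [1 / (2d)]; the radius lets each vary by at most
     that much, so they stay between 0 and [1 / d]. *)
  pose u : 'rV[R]_d := const_mx (2 * d%:R)^-1.
  exists (q ord0 + u *m V), ((2 * d%:R)^-1 / (C + 1)).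
  have dV : 0 < (2 * d%:R)^-1 :> R by rewrite invr_gt0 mulr_gt0.
  split; first by rewrite divr_gt0 //; lra.
  move=> x; rewrite -ball_normE /= => xr.
  have dt i : `|u 0 i - t x 0 i| <= (2 * d%:R)^-1.
    have -> : u 0 i - t x 0 i = ((q ord0 + u *m V - x) *m invmx V) 0 i.
      have -> : q ord0 + u *m V - x = (u - t x) *m V.
        by rewrite mulmxBl {1}(tK x) opprD addrACA subrr add0r.
      by rewrite mulmxK // [RHS]mxE; congr (_ + _); rewrite [RHS]mxE.
    rewrite mxE (le_trans (ler_norm_sum _ _ _)) //.
    apply: (@le_trans _ _ (\sum_j (2 * d%:R)^-1 / (C + 1) * `|invmx V j i|)).
      apply: ler_sum => j _; rewrite normrM ler_wpM2r //.
      exact: le_trans (row_entry_norm_le _ _) (ltW xr).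
    rewrite -mulr_sumr -mulrA ger_pMr // mulrC ler_pdivrMr ?mul1r; last lra.
    rewrite (@le_trans _ _ C) ?lerDl // ler_sum // => j _.
    by rewrite (bigD1 i) //= lerDl sumr_ge0.
  split=> [i|].
    by have := dt i; rewrite mxE ler_norml => /andP[_]; lra.
  apply: (@le_trans _ _ (\sum_(i < d) d%:R^-1)); last first.
    by rewrite sumr_const card_ord -[_ *+ d]mulr_natr mulVf // gt_eqF.
  apply: ler_sum => i _; have := dt i; rewrite mxE ler_norml => /andP[+ _].
  by have -> : d%:R^-1 = (2 * d%:R)^-1 + (2 * d%:R)^-1 :> R; [field; rewrite gt_eqF | lra].
- move=> x [t0 t1].
  have [[i ti]|no_big] := pselect (exists i, 1 - rho <= t x 0 i).
    pose u : 'rV[R]_d := rho^-1 *: (t x - (1 - rho) *: delta_mx 0 i).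
    have uE j : u 0 j = rho^-1 * (t x 0 j - (1 - rho) * (j == i)%:R) by rewrite !mxE eqxx.
    exists (f i), (q ord0 + u *m V); split.
      rewrite /D /= tE; split=> [j|].
        rewrite uE; apply: mulr_ge0; first by rewrite invr_ge0 ltW.
        rewrite subr_ge0.
        by case: eqVneq => [->|_]; rewrite ?mulr1 ?mulr0.
      rewrite (eq_bigr _ (fun j _ => uE j)) -mulr_sumr sumrB -mulr_sumr.
      have -> : \sum_(j < d) (j == i)%:R = 1 :> R.
        by rewrite (bigD1 i) //= eqxx big1 ?addr0 // => j /negPf ->.
      by rewrite mulr1 ler_pdivrMl // mulr1; lra.
    rewrite -scalemxAl scalerDr scalerA divff ?gt_eqF // scale1r mulmxBl -scalemxAl.
    rewrite -rowE rowV [LHS](tK x); move: (t x *m V) (q (f i)) => v v'.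
    by apply/rowP => j; rewrite !mxE; ring.
  (* All [t x 0 j] are below [1 - rho], so their sum is at most [d (1 - rho) <= rho] and the vertex
     [q ord0] serves. *)
  exists ord0, (q ord0 + (rho^-1 *: t x) *m V); split.
    rewrite /D /= tE; split=> [j|]; first by rewrite mxE mulr_ge0 // invr_ge0 ltW.
    under eq_bigr => j _ do rewrite mxE.
    rewrite -mulr_sumr ler_pdivrMl // mulr1.
    apply: (@le_trans _ _ (\sum_(j < d) (1 - rho))).
      apply: ler_sum => j _; rewrite leNgt; apply/negP => /ltW tj.
      by apply: no_big; exists j.
    rewrite sumr_const card_ord -[_ *+ d]mulr_natr.
    move: rho_ge; rewrite ler_pdivrMr ?ltr0n // -natr1; lra.
  rewrite -scalemxAl scalerDr scalerA divff ?gt_eqF // scale1r [LHS](tK x).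
  by move: (t x *m V) => v; apply/rowP => j; rewrite !mxE; ring.
Qed.

End Simplex.

(** * Porous sets are null *)

Section Porous.
Variables (R : realType) (d : nat).
Hypothesis d_gt0 : (0 < d)%N.

Definition cube (x : 'rV[R]_d) (l : R) : set 'rV[R]_d :=
  [set y | forall i, x 0 i <= y 0 i <= x 0 i + l].

Definition porous (E : set 'rV[R]_d) (l0 : R) : Prop :=
  exists2 kap : R, 0 < kap & forall x l, E x -> 0 < l <= l0 ->
    exists z, ball z (kap * l) `<=` ball x l `\` E.

Section Subdivision.
Variable M : nat.
Hypothesis M_gt0 : (0 < M)%N.

Let M0 : 0 < M%:R :> R. Proof. by rewrite ltr0n. Qed.

Definition subcorner (x : 'rV[R]_d) (l : R) (g : {ffun 'I_d -> 'I_M}) : 'rV[R]_d :=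
  \row_i (x 0 i + l / M%:R * (g i)%:R).

Lemma subcube_cover (x y : 'rV[R]_d) (l : R) : 0 < l -> cube x l y ->
  exists g, cube (subcorner x l g) (l / M%:R) y.
Proof.
move=> l0 xy; have lM : 0 < l / M%:R by rewrite divr_gt0.
suff ex i : exists m : 'I_M, x 0 i + l / M%:R * m%:R <= y 0 i <= x 0 i + l / M%:R * m%:R + l / M%:R.
  by have [g gP] := choice ex; exists [ffun i => g i] => i; rewrite mxE ffunE.
have /andP[xy1 xy2] := xy i.
(* On the upper face truncation would give the index [M], so the last subcube is taken. *)
have [->|yl] := eqVneq (y 0 i) (x 0 i + l).
  have Mp : (M.-1 < M)%N by rewrite prednK.
  exists (Ordinal Mp) => /=.
  have -> : x 0 i + l = x 0 i + l / M%:R * M.-1%:R + l / M%:R.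
    by rewrite -addrA -[X in _ + (_ + X)]mulr1 -mulrDr natr1 prednK // divfK // gt_eqF.
  by rewrite lexx andbT lerDl ltW.
pose v := (y 0 i - x 0 i) / (l / M%:R).
have v0 : 0 <= v by rewrite divr_ge0 ?subr_ge0 // ltW.
have vM : v < M%:R.
  rewrite ltr_pdivrMr // mulrCA divff ?gt_eqF // mulr1 ltrBlDl lt_neqAle yl.
  exact: xy2.
have /andP[t1 t2] := truncn_itv v0.
have tM : (Num.truncn v < M)%N by rewrite -(ltr_nat R) (le_lt_trans t1).
exists (Ordinal tM) => /=; move: t1 t2; rewrite -addn1 natrD.
rewrite ler_pdivlMr // ltr_pdivrMr //.
set m := (Num.truncn v)%:R; set c := l / M%:R => t1 t2; apply/andP; split; lra.
Qed.

End Subdivision.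

(** If the subcube at the centre meets [E] in [y], the hole near [y] lies in the cube and swallows
    the subcube around the centre of the hole. *)
Lemma porous_subdivision (E : set 'rV[R]_d) (l0 : R) : porous E l0 ->
  exists2 M : nat, (0 < M)%N & forall x l, 0 < l <= l0 ->
    exists g : {ffun 'I_d -> 'I_M}, cube (subcorner x l g) (l / M%:R) `&` E = set0.
Proof.
move=> [kap kap0 porE].
(* More than 4 keeps [y] at least [l / 4] from the faces; more than [4 / kap] makes the side of a
   subcube smaller than the radius of the hole. *)
have [M MK] : exists M : nat, 4 + 4 / kap < M%:R.
  exists (Num.truncn (4 + 4 / kap)).+1.
  have /truncn_itv/andP[] // : 0 <= 4 + 4 / kap by rewrite addr_ge0 // divr_ge0 // ltW.
have kap4 : 0 < 4 / kap by rewrite divr_gt0.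
have M0 : 0 < M%:R :> R by lra.
have M_gt0 : (0 < M)%N by rewrite -(ltr0n R).
exists M => // x l /andP[l_gt0 ll0].
pose x1 : 'rV[R]_d := x + const_mx (l / 2).
have x1i i : x1 0 i = x 0 i + l / 2 by rewrite !mxE.
have lM : 0 < l / M%:R by rewrite divr_gt0.
have lM4 : l / M%:R < l / 4 by rewrite ltr_pM2l // ltf_pV2 ?posrE //; lra.
have [] := @subcube_cover M M_gt0 x x1 l l_gt0.
  by move=> i; rewrite x1i; apply/andP; split; lra.
move=> g x1g; have [|/set0P[y [yg Ey]]] := eqVneq (cube (subcorner x l g) (l / M%:R) `&` E) set0.
  by exists g.
have y_near i : x 0 i + l / 4 <= y 0 i <= x 0 i + l - l / 4.
  have := yg i; have := x1g i; rewrite x1i; lra.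
have [|z zy] := porE y (l / 4) Ey; first by lra.
have r0 : 0 < kap * (l / 4) by rewrite mulr_gt0 //; lra.
have lMr : l / M%:R < kap * (l / 4).
  rewrite ltr_pdivrMr //.
  have : 4 / kap * (kap * (l / 4)) < M%:R * (kap * (l / 4)) by rewrite ltr_pM2r //; lra.
  have -> : 4 / kap * (kap * (l / 4)) = l by field; rewrite gt_eqF.
  by rewrite [M%:R * _]mulrC.
have zx : cube x l z.
  have [/=] := zy z (ballxx _ r0); rewrite -ball_normE /= => yz _ i.
  have := le_lt_trans (row_entry_norm_le (y - z) i) yz; rewrite !mxE ltr_norml.
  have := y_near i; lra.
have [h zh] := subcube_cover M_gt0 l_gt0 zx.
exists h; apply/seteqP; split => // v [vh Ev].
have [] := zy v; last by [].
rewrite -ball_normE /=; apply: le_lt_trans lMr.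
apply: row_norm_le; rewrite ?ltW // => i; rewrite !mxE ler_norml.
have := vh i; have := zh i; lra.
Qed.

(** Each refinement discards from every cube one of its [M ^ d] subcubes, one that misses [E]. *)
Lemma porous_cover (E : set 'rV[R]_d) (l0 : R) : porous E l0 ->
  exists2 M : nat, (0 < M)%N & forall j x, 0 < l0 ->
    exists2 s : seq 'rV[R]_d, (size s <= (M ^ d).-1 ^ j)%N &
      forall y, E y -> cube x l0 y -> exists2 c, c \in s & cube c (l0 / M%:R ^+ j) y.
Proof.
move=> /porous_subdivision[M M_gt0 sub]; exists M => // j x l0_gt0.
have M0 : 0 < M%:R :> R by rewrite ltr0n.
have M1 : 1 <= M%:R :> R by rewrite ler1n.
elim: j => [|j [s size_s coverE]].
  exists [:: x] => // y _ xy; exists x; rewrite ?mem_head //.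
  by rewrite expr0 divr1.
have lj0 : 0 < l0 / M%:R ^+ j by rewrite divr_gt0 // exprn_gt0.
have lj : 0 < l0 / M%:R ^+ j <= l0.
  by rewrite lj0 ler_pdivrMr ?exprn_gt0 // ler_peMr ?exprn_ege1 // ltW.
have ex c : exists g : {ffun 'I_d -> 'I_M},
    cube (subcorner c (l0 / M%:R ^+ j) g) (l0 / M%:R ^+ j / M%:R) `&` E = set0 by exact: sub.
have [f fP] := choice ex.
exists (flatten [seq [seq subcorner c (l0 / M%:R ^+ j) g | g <- enum (predC1 (f c))] | c <- s]).
  have -> : forall s' : seq 'rV[R]_d,
      size (flatten [seq [seq subcorner c (l0 / M%:R ^+ j) g | g <- enum (predC1 (f c))]
                    | c <- s']) = (size s' * (M ^ d).-1)%N.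
    elim=> //= c s' IHs; rewrite size_cat IHs size_map -cardE cardC1 card_ffun !card_ord.
    by rewrite mulSn.
  by rewrite expnSr leq_mul2r size_s orbT.
move=> y Ey xy; have [c cs cy] := coverE y Ey xy.
have [g gy] := subcube_cover M_gt0 lj0 cy.
exists (subcorner c (l0 / M%:R ^+ j) g).
  apply/flattenP; exists [seq subcorner c (l0 / M%:R ^+ j) g | g <- enum (predC1 (f c))].
    by apply/mapP; exists c.
  apply: map_f; rewrite mem_enum inE; apply/eqP => gf.
  by have /seteqP[/(_ y) + _] := fP c; rewrite -gf; apply.
by move=> i; have := gy i; rewrite exprSr invfM mulrA.
Qed.

(** The cover at level [j] has volume at most [l0 ^+ d * b ^+ j] with [b < 1]. *)
Lemma porous_null (E : set 'rV[R]_d) (x : 'rV[R]_d) (l0 : R) : 0 < l0 ->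
  E `<=` cube x l0 -> porous E l0 -> lebesgue_null E.
Proof.
move=> l0_gt0 Ex /porous_cover[M M_gt0 coverE] e e0.
have M0 : 0 < M%:R :> R by rewrite ltr0n.
pose b : R := (M ^ d).-1%:R / (M ^ d)%:R.
have b1 : `|b| < 1.
  rewrite ger0_norm ?divr_ge0 // ltr_pdivrMr ?mul1r ?ltr_nat ?ltr0n ?expn_gt0 ?M_gt0 //.
  by rewrite prednK // expn_gt0 M_gt0.
have e'0 : 0 < e / l0 ^+ d by rewrite divr_gt0 // exprn_gt0.
have /cvgrPdist_lt/(_ _ e'0)[j _ /(_ j (leqnn j))] := cvg_expr b1.
rewrite sub0r normrN => bj; have [s size_s coverj] := coverE j x l0_gt0.
pose l := l0 / M%:R ^+ j; have l_gt0 : 0 < l by rewrite divr_gt0 // exprn_gt0.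
(* Beyond the list the boxes degenerate to points, of volume 0 because [d] is positive. *)
pose side m := if (m < size s)%N then l else 0.
have side0 m : 0 <= side m by rewrite /side; case: ifP => // _; exact: ltW.
exists (nth 0 s), (fun m => nth 0 s m + const_mx (side m)); split.
  by move=> m i; rewrite !mxE lerDl.
split.
  move=> y Ey; have [c cs cy] := coverj y Ey (Ex y Ey).
  exists (index c s) => // i; rewrite nth_index // !mxE /side index_mem cs.
  exact: cy.
move=> K; apply: (@le_trans _ _ (\sum_(m < K) if (m < size s)%N then l ^+ d else 0)).
  apply: ler_sum => m _.
  rewrite (eq_bigr (fun=> side m)) => [|i _]; last by rewrite !mxE addrAC subrr add0r.
  rewrite prodr_const card_ord /side; case: ifP => // _.
  by rewrite expr0n gtn_eqF.
rewrite -big_mkcond /= sumr_const -[_ *+ _]mulr_natr.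
have size_K : (#|[pred m : 'I_K | (m < size s)%N]| <= size s)%N.
  rewrite cardE -(size_map val) -[X in (_ <= X)%N](size_iota 0); apply: uniq_leq_size.
    by rewrite map_inj_uniq ?enum_uniq //; exact: val_inj.
  by move=> _ /mapP[m + ->]; rewrite mem_enum inE mem_iota.
apply: (@le_trans _ _ (l ^+ d * (M ^ d).-1%:R ^+ j)).
  by rewrite ler_pM2l ?exprn_gt0 // -natrX ler_nat (leq_trans size_K).
have -> : l ^+ d * (M ^ d).-1%:R ^+ j = l0 ^+ d * b ^+ j.
  rewrite /l /b !expr_div_n natrX -!exprM [(j * d)%N]mulnC; ring.
rewrite mulrC -ler_pdivlMr ?exprn_gt0 //; exact: le_trans (ler_norm _) (ltW bj).
Qed.

End Porous.

(** * Normal points of the attractor *)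

Section NormalCodings.
Variables (R : realType) (d n k : nat) (lam : 'rV[R]_n.+1) (p : 'I_n.+1 -> 'rV[R]_d).
Hypotheses (lam01 : forall i, 0 < lam 0 i < 1) (k_gt0 : (0 < k)%N).

(** Bounded discrepancy implies simple normality and, by [bounded_discrepancy_cons], makes this set
    invariant under the maps. *)
Definition normal_points : set 'rV[R]_d :=
  [set x | exists a, bounded_discrepancy k a /\ coding lam p a x].

Lemma normal_points_compS (a : nat -> 'I_n.+1) (j : nat) (x : 'rV[R]_d) :
  normal_points x -> normal_points (compS lam p a j x).
Proof.
elim: j x => //= j IHj x [b [db bx]]; apply: IHj; exists (cons_seq (a j) b).
by split; [exact: bounded_discrepancy_cons | exact: coding_cons].
Qed.

Lemma ball_compS (Y : set 'rV[R]_d) (a : nat -> 'I_n.+1) (j : nat) (y : 'rV[R]_d) (r : R) :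
  (forall x, Y x -> Y (compS lam p a j x)) -> ball y r `<=` Y ->
  ball (compS lam p a j y) (wprod lam a j * r) `<=` Y.
Proof.
move=> Yinv yr z; rewrite -ball_normE /= => zr.
have w_gt0 : 0 < wprod lam a j by exact: wprod_gt0.
pose x := y - (wprod lam a j)^-1 *: (compS lam p a j y - z).
have xy : compS lam p a j y - compS lam p a j x = compS lam p a j y - z.
  by rewrite compS_sub /x opprB addrC subrK scalerA divff ?gt_eqF // scale1r.
have -> : z = compS lam p a j x by apply/oppr_inj/(addrI (compS lam p a j y)); rewrite xy.
apply/Yinv/yr; rewrite -ball_normE /= /x opprB addrC subrK normrZ.
by rewrite normfV gtr0_norm // mulrC ltr_pdivrMr // mulrC.
Qed.

(** Following a point of the simplex back through [simplex_self_cover] yields vertices [c m]. Then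
    [splice k c] codes the point, as its tails at the times [L * m] stay in the simplex. *)
Lemma normal_points_ball : (0 < d)%N -> not_in_hyperplane p ->
  d%:R / d.+1%:R <= period_ratio k lam ->
  exists x r, 0 < r /\ ball x r `<=` normal_points.
Proof.
move=> d_gt0 np rho_ge; pose L := (k * n.+1 ^ k)%N.
have nq := period_points_not_in_hyperplane lam01 k_gt0 np.
have [D [[r Dr] [x [e [e0 xD]]] cover]] := simplex_self_cover d_gt0 nq rho_ge
  (period_ratio_gt0 _ lam01).
exists x, e; split => // x0 /xD {x xD e e0} Dx0.
have next x : exists cy : 'I_n.+1 * 'rV[R]_d, D x ->
    D cy.2 /\ x = period_map k lam p (k * cy.1) cy.2.
  have [Dx|nDx] := pselect (D x); last by exists (ord0, x).
  have [c [y [Dy xE]]] := cover x Dx; exists (c, y) => _; split=> //=.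
  by rewrite period_mapE.
have [f fP] := choice next.
pose y m := iter m (fun z => (f z).2) x0.
have Dy m : D (y m) by elim: m => //= m /fP[].
pose c m := (f (y m)).1.
exists (splice k c); split; first exact: splice_bounded_discrepancy.
apply: (@coding_of_bounded_tails _ _ _ _ _ lam01 _ _ r) => m.
exists (L * m)%N; first by rewrite leq_pmull // period_gt0.
exists (y m); first exact/Dr/Dy.
elim: m => [|m {1}->]; first by rewrite muln0.
rewrite mulnS [(L + _)%N]addnC compSD; congr compS.
have [_ {1}->] := fP _ (Dy m); apply: eq_compS => i iL.
by rewrite [(L * m + i)%N]addnC splice_block // addnC.
Qed.

(** A coding of [x] is cut at the first [j] where [wprod] falls to [l / K]; it is then still at
    least [mu * l / K], so the copy of the ball in [Y] has size comparable to [l]. *)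
Lemma attractor_holes (X Y : set 'rV[R]_d) (l0 : R) : is_attractor lam p X -> 0 < l0 ->
  (forall a j x, Y x -> Y (compS lam p a j x)) ->
  (exists x r, 0 < r /\ ball x r `<=` Y) ->
  exists2 kap : R, 0 < kap & forall x l, X x -> 0 < l <= l0 ->
    exists z, ball z (kap * l) `<=` ball x l `&` Y.
Proof.
move=> attrX l0_gt0 Yinv [y0 [r [r0 yY]]].
have [s s0 Xs] := attractor_bounded attrX.
have [mu mu0 lam_mu] := lam_lower_bound lam01.
(* The first three terms keep the copy of the ball within [l] of [x]; [l0] ensures [th <= 1], which
   the case [j = 0] needs. *)
pose K := `|y0| + s + r + l0.
have K0 : 0 < K by rewrite /K; have := normr_ge0 y0; lra.
exists (mu * r / K) => [|x l Xx /andP[l_gt0 ll0]]; first by rewrite divr_gt0 // mulr_gt0.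
have [a tails] := attractor_tails attrX Xx.
pose th := l / K.
have th0 : 0 < th by rewrite divr_gt0.
have th1 : th <= 1.
  by rewrite ler_pdivrMr // mul1r /K; have := normr_ge0 y0; lra.
have ex : exists j, wprod lam a j <= th.
  by have [m small] := wprod_small lam01 th0; exists m; rewrite ltW // small.
have [j j_th j_min] := ex_minnP ex.
have mu_j : mu * th <= wprod lam a j.
  case: j j_th j_min => [|j] j_th j_min.
    rewrite /wprod big_ord0; have /andP[_ l1] := lam01 ord0; have := lam_mu ord0 => mul.
    by rewrite mulr_ile1 // ltW // (le_lt_trans mul).
  have th_lt : th < wprod lam a j by rewrite ltNge; apply/negP => /j_min; rewrite ltnn.
  by rewrite wprodS mulrC ler_pM // ltW.
have [y Xy xE] := tails j.
have w0 := wprod_gt0 lam01 a j.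
exists (compS lam p a j y0) => z zr.
have zr' : ball (compS lam p a j y0) (wprod lam a j * r) z.
  apply: le_ball zr; have -> : mu * r / K * l = mu * th * r by rewrite /th; ring.
  by rewrite ler_pM2r.
split; last by apply: (ball_compS (Yinv a j) yY).
move: zr'; rewrite -!ball_normE /= => zr'; rewrite xE.
rewrite -(subrKA (compS lam p a j y0)) (le_lt_trans (ler_normD _ _)) //.
rewrite compS_sub normrZ gtr0_norm //.
have yy : `|y - y0| <= s + `|y0| by rewrite (le_trans (ler_normB _ _)) // lerD2r Xs.
apply: (@lt_le_trans _ _ (wprod lam a j * (s + `|y0|) + wprod lam a j * r)).
  by rewrite ler_ltD // ler_pM2l.
rewrite -mulrDr; apply: (@le_trans _ _ (th * K)).
  apply: ler_pM => //; [exact: ltW | by have := normr_ge0 y0; lra |].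
  by rewrite /K; lra.
by rewrite divfK // gt_eqF.
Qed.

End NormalCodings.

Unset Implicit Arguments.

Theorem theorem3p2 (R : realType) (d n k : nat) (p : 'I_n.+1 -> 'rV[R]_d) :
  (0 < d)%N -> not_in_hyperplane p -> (1 <= k)%N ->
  exists Ob : set 'rV[R]_n.+1,
    Ob `<=` Pk d n k /\ rel_open Ob (Pk d n k) /\ rel_dense Ob (Pk d n k) /\
    forall lam, Ob lam ->
      forall X : set 'rV[R]_d, is_attractor lam p X ->
        (exists A, rel_open A X /\ rel_dense A X /\ A `<=` Xk k lam p X) /\
        lebesgue_null (X `\` Xk k lam p X).
Proof.
move=> d_gt0 np k_gt0; exists (Pk d n k); split=> //; split.
  by split=> //; exists setT; split; [exact: openT | rewrite setTI].
split; first exact: subset_closure.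
move=> lam [lam01 rho_ge] X attrX.
have YX : normal_points k lam p `<=` X.
  by move=> x [a [_ /(coding_attractor lam01 attrX)]].
have YXk : normal_points k lam p `<=` Xk k lam p X.
  move=> x Yx; split; first exact: YX.
  have [a [da ax]] := Yx; exists a; split => //; exact: bounded_discrepancy_normal.
have Yball := normal_points_ball lam01 k_gt0 d_gt0 np rho_ge.
have Yinv := @normal_points_compS R d n k lam p.
split.
  (* Near any point of [X] and at any scale, [attractor_holes] finds a ball of normal points; its
     centre is interior, which gives density. *)
  exists (interior (normal_points k lam p)); split.
    split; first by move=> x /interior_subset/YX.
    exists (interior (normal_points k lam p)); split; first exact: open_interior.
    by apply/esym/setIidPl => x /interior_subset/YX.
  split; last by move=> x /interior_subset/YXk.
  move=> x Xx B /nbhs_ballP[e /= e0 eB].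
  have [kap kap0 holes] := attractor_holes lam01 attrX e0 Yinv Yball.
  have [|z zx] := holes x e Xx; first by rewrite e0 lexx.
  have ke0 : 0 < kap * e by rewrite mulr_gt0.
  exists z; split; last by apply: eB; have [] := zx z (ballxx _ ke0).
  by apply/nbhs_ballP; exists (kap * e) => // y /zx[].
have [r r0 Xr] := attractor_bounded attrX.
have r2 : 0 < 2 * r by rewrite mulr_gt0.
(* The cube of centre 0 and side [2 * r] contains [X]; balls of normal points are the holes that
   make the complement of [Xk] in [X] porous. *)
apply: (@porous_null _ _ d_gt0 _ (const_mx (- r)) (2 * r)) => //.
  move=> x [/Xr xr _] i; have := le_trans (row_entry_norm_le x i) xr.
  by rewrite !mxE ler_norml => /andP[? ?]; apply/andP; split; lra.
have [kap kap0 holes] := attractor_holes lam01 attrX r2 Yinv Yball.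
exists kap => // x l [Xx _] lr; have [z zx] := holes x l Xx lr.
by exists z => y /zx[xy /YXk Xky]; split=> // -[].
Qed.
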